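(* Let $(\bar x,\bar y)\in\mathbb{R}^n\times\mathbb{R}^n$ be a feasible point of the relaxed problem (RP). Then $(\bar x,\bar y)$ is $AW$-stationary for (RP) if and only if it is an AKKT point for the tightened problem $\mathrm{TNLP}_{I_0}(\bar x,\bar y)$.
   Context: Setting. Let $\alpha,n$ be natural numbers with $0<\alpha<n$, and let $f:\mathbb{R}^n\to\mathbb{R}$, $g:\mathbb{R}^n\to\mathbb{R}^m$, $h:\mathbb{R}^n\to\mathbb{R}^p$ be continuously differentiable. Let $e=(1,\ldots,1)\in\mathbb{R}^n$ and define $\theta(y)=n-\alpha-e^Ty\in\mathbb{R}$, $G(x)=x$, $H(y)=-y$, $\tilde H(y)=y-e$ for $x,y\in\mathbb{R}^n$. Let $*$ denote the componentwise (Hadamard) product; vector inequalities and the minimum $\min\{\cdot,\cdot\}$ of vectors are taken componentwise. The relaxed problem (RP) (a continuous reformulation of minimizing $f(x)$ subject to $g(x)\le 0$, $h(x)=0$ and $x$ having at most $\alpha$ nonzero components) is: minimize $f(x)$ over $(x,y)\in\mathbb{R}^n\times\mathbb{R}^n$ subject to $g(x)\le 0$, $h(x)=0$, $\theta(y)\le 0$, $H(y)\le 0$, $\tilde H(y)\le 0$, $G(x)*H(y)=0$. Index sets. For a feasible $(\bar x,\bar y)$ of (RP): $I_0=\{i\mid\bar x_i=0\}$, $I_{00}=\{i\mid\bar x_i=0,\bar y_i=0\}$, $I_{\pm0}=\{i\mid\bar x_i\ne0,\bar y_i=0\}$, $I_{0+}=\{i\mid\bar x_i=0,\bar y_i\in(0,1)\}$,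 $I_{01}=\{i\mid\bar x_i=0,\bar y_i=1\}$. Tightened problem. $\mathrm{TNLP}_{I_0}(\bar x,\bar y)$ is the problem: minimize $f(x)$ over $(x,y)\in\mathbb{R}^n\times\mathbb{R}^n$ subject to $g(x)\le0$, $h(x)=0$, $\theta(y)\le0$, $G_i(x)=0$ for $i\in I_0$, $H_i(y)\le0$ for $i\in I_{0+}\cup I_{01}$, $H_i(y)=0$ for $i\in I_{00}\cup I_{\pm0}$, $\tilde H(y)\le0$. Definition (AKKT). For a general nonlinear program: minimize $F(z)$ over $z\in\mathbb{R}^N$ subject to $a(z)\le 0$, $b(z)=0$, with $F:\mathbb{R}^N\to\mathbb{R}$, $a:\mathbb{R}^N\to\mathbb{R}^M$, $b:\mathbb{R}^N\to\mathbb{R}^P$ continuously differentiable, a feasible point $\bar z$ is an Approximate KKT (AKKT) point if there exist sequences $(z^k)\subset\mathbb{R}^N$ and $(\lambda^{a,k},\lambda^{b,k})\subset\mathbb{R}_+^M\times\mathbb{R}^P$ such that $z^k\to\bar z$, $\nabla F(z^k)+\sum_{i=1}^M\lambda_i^{a,k}\nabla a_i(z^k)+\sum_{j=1}^P\lambda_j^{b,k}\nabla b_j(z^k)\to 0$ and $\min\{-a(z^k),\lambda^{a,k}\}\to 0$. It is applied to $\mathrm{TNLP}_{I_0}(\bar x,\bar y)$ with $z=(x,y)$ and the inequality and equality constraints as listed in that problem. Let $L(x,\lambda^g,\lambda^h)=f(x)+(\lambda^g)^Tg(x)+(\lambda^h)^Th(x)$ and, for $\lambda=(\lambda^g,\lambda^h,\lambda^\theta,\lambda^G,\lambda^H,\lambda^{\tilde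 H})$, let $$\mathcal{L}(x,y,\lambda)=L(x,\lambda^g,\lambda^h)+\lambda^\theta\theta(y)+(\lambda^G)^TG(x)+(\lambda^H)^TH(y)+(\lambda^{\tilde H})^T\tilde H(y).$$ Definition ($AW$-stationarity). A feasible point $(\bar x,\bar y)$ of (RP) is called $AW$-stationary (Approximately Weakly stationary) for (RP) if there exist sequences $(x^k,y^k)\subset\mathbb{R}^n\times\mathbb{R}^n$ and $\lambda^k=(\lambda^{g,k},\lambda^{h,k},\lambda^{\theta,k},\lambda^{G,k},\lambda^{H,k},\lambda^{\tilde H,k})\in\mathbb{R}_+^m\times\mathbb{R}^p\times\mathbb{R}_+\times\mathbb{R}^n\times\mathbb{R}^n\times\mathbb{R}_+^n$ such that, as $k\to\infty$: (1) $(x^k,y^k)\to(\bar x,\bar y)$; (2) $\nabla_{x,y}\mathcal{L}(x^k,y^k,\lambda^k)\to 0$; (3) $\min\{-g(x^k),\lambda^{g,k}\}\to 0$; (4) $\min\{-\theta(y^k),\lambda^{\theta,k}\}\to 0$; (5) $\min\{|G_i(x^k)|,|\lambda_i^{G,k}|\}\to 0$ for all $i=1,\ldots,n$; (6) $\min\{-H_i(y^k),|\lambda_i^{H,k}|\}\to 0$ for all $i=1,\ldots,n$; (7) $\min\{-\tilde H(y^k),\lambda^{\tilde H,k}\}\to 0$. *)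

(* Defs.v *)
From HB Require Import structures.
From mathcomp Require Import all_boot all_order all_algebra.
From mathcomp Require Import all_classical all_reals all_analysis.

Set Implicit Arguments.
Unset Strict Implicit.
Unset Printing Implicit Defensive.

Import Order.TTheory GRing.Theory Num.Theory.
Import numFieldNormedType.Exports.

Local Open Scope classical_set_scope.
Local Open Scope ring_scope.

Section vectors.
Context {R : realType}.

Definition vle N (u v : 'rV[R]_N) : Prop := forall i, u 0 i <= v 0 i.

Definition vmin N (u v : 'rV[R]_N) : 'rV[R]_N := map2_mx Num.min u v.

Definition hadamard N (u v : 'rV[R]_N) : 'rV[R]_N := map2_mx *%R u v.

Definition dot N (u v : 'rV[R]_N) : R := \sum_i u 0 i * v 0 i.

Definition ones N : 'rV[R]_N := const_mx 1.

(* (v_i)_{i \in A}, listed in the order of [enum A] *)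
Definition subvec N (A : {set 'I_N}) (v : 'rV[R]_N) : 'rV[R]_#|A| :=
  \row_k v 0 (enum_val k).

Definition grad N (F : 'rV[R]_N -> R) (z : 'rV[R]_N) : 'rV[R]_N :=
  \row_i 'D_(delta_mx 0 i) F z.

Definition continuously_differentiable N (W : normedModType R)
    (F : 'rV[R]_N -> W) : Prop :=
  (forall z, differentiable F z) /\
  (forall i, continuous ('D_(delta_mx 0 i) F : 'rV[R]_N -> W)).

End vectors.

(* minimize [objective z] subject to [ineq z <= 0] and [equa z = 0] *)
Record nlp (R : realType) (N M P : nat) := Nlp {
  objective : 'rV[R]_N -> R ;
  ineq : 'rV[R]_N -> 'rV[R]_M ;
  equa : 'rV[R]_N -> 'rV[R]_P }.

Definition feasible (R : realType) N M P (Q : nlp R N M P) (z : 'rV[R]_N) :=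
  vle (ineq Q z) 0 /\ equa Q z = 0.

Definition AKKT (R : realType) N M P (Q : nlp R N M P) (zbar : 'rV[R]_N) :=
  feasible Q zbar /\
  exists (z : nat -> 'rV[R]_N)
         (la : nat -> 'rV[R]_M) (lb : nat -> 'rV[R]_P),
    [/\ forall k, vle 0 (la k),
        z @ \oo --> zbar,
        (fun k => grad (objective Q) (z k)
           + \sum_(i < M) la k 0 i *: grad (fun w => ineq Q w 0 i) (z k)
           + \sum_(j < P) lb k 0 j *: grad (fun w => equa Q w 0 j) (z k))
          @ \oo --> (0 : 'rV[R]_N)
      & (fun k => vmin (- ineq Q (z k)) (la k)) @ \oo --> (0 : 'rV[R]_M)].

(* A pair (x, y) in R^n x R^n is encoded as [row_mx x y] in R^(n + n); its
   components are recovered by [lsubmx] and [rsubmx]. *)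
Section relaxed_problem.
Context {R : realType} (alpha n m p : nat).
Variables (f : 'rV[R]_n -> R) (g : 'rV[R]_n -> 'rV[R]_m)
          (h : 'rV[R]_n -> 'rV[R]_p).

Definition theta (y : 'rV[R]_n) : R := n%:R - alpha%:R - dot (ones n) y.
Definition Gc (x : 'rV[R]_n) : 'rV[R]_n := x.
Definition Hc (y : 'rV[R]_n) : 'rV[R]_n := - y.
Definition Htilde (y : 'rV[R]_n) : 'rV[R]_n := y - ones n.

Definition RP : nlp R (n + n) (m + (1 + (n + n))) (p + n) := {|
  objective z := f (lsubmx z) ;
  ineq z := let x := lsubmx z in let y := rsubmx z in
    row_mx (g x) (row_mx (const_mx (theta y)) (row_mx (Hc y) (Htilde y))) ;
  equa z := let x := lsubmx z in let y := rsubmx z in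
    row_mx (h x) (hadamard (Gc x) (Hc y)) |}.

Section index_sets.
Variables xbar ybar : 'rV[R]_n.
Definition I_0 : {set 'I_n} := [set i | xbar 0 i == 0]%SET.
Definition I_00 : {set 'I_n} :=
  [set i | (xbar 0 i == 0) && (ybar 0 i == 0)]%SET.
Definition I_pm0 : {set 'I_n} :=
  [set i | (xbar 0 i != 0) && (ybar 0 i == 0)]%SET.
Definition I_0plus : {set 'I_n} :=
  [set i | (xbar 0 i == 0) && (0 < ybar 0 i < 1)]%SET.
Definition I_01 : {set 'I_n} :=
  [set i | (xbar 0 i == 0) && (ybar 0 i == 1)]%SET.

Definition TNLP : nlp R (n + n)
    (m + (1 + (#|I_0plus :|: I_01| + n)))
    (p + (#|I_0| + #|I_00 :|: I_pm0|)) := {|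
  objective z := f (lsubmx z) ;
  ineq z := let x := lsubmx z in let y := rsubmx z in
    row_mx (g x) (row_mx (const_mx (theta y))
      (row_mx (subvec (I_0plus :|: I_01) (Hc y)) (Htilde y))) ;
  equa z := let x := lsubmx z in let y := rsubmx z in
    row_mx (h x)
      (row_mx (subvec I_0 (Gc x)) (subvec (I_00 :|: I_pm0) (Hc y))) |}.
End index_sets.

Definition L (x : 'rV[R]_n) (lg : 'rV[R]_m) (lh : 'rV[R]_p) : R :=
  f x + dot lg (g x) + dot lh (h x).

Definition Lagrangian (x y : 'rV[R]_n) (lg : 'rV[R]_m) (lh : 'rV[R]_p)
    (lt : R) (lG lH lHt : 'rV[R]_n) : R :=
  L x lg lh + lt * theta y + dot lG (Gc x) + dot lH (Hc y)
  + dot lHt (Htilde y).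

Definition AW_stationary (xbar ybar : 'rV[R]_n) : Prop :=
  feasible RP (row_mx xbar ybar) /\
  exists (x y : nat -> 'rV[R]_n)
         (lg : nat -> 'rV[R]_m) (lh : nat -> 'rV[R]_p) (lt : nat -> R)
         (lG lH lHt : nat -> 'rV[R]_n),
    (forall k, [/\ vle 0 (lg k), 0 <= lt k & vle 0 (lHt k)]) /\
    [/\ x @ \oo --> xbar /\ y @ \oo --> ybar,
        (fun k => grad (fun z : 'rV[R]_(n + n) =>
             Lagrangian (lsubmx z) (rsubmx z)
               (lg k) (lh k) (lt k) (lG k) (lH k) (lHt k))
           (row_mx (x k) (y k))) @ \oo --> (0 : 'rV[R]_(n + n)),
        (fun k => vmin (- g (x k)) (lg k)) @ \oo --> (0 : 'rV[R]_m)
      & (fun k => Num.min (- theta (y k)) (lt k)) @ \oo --> (0 : R)] /\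
    [/\ forall i, (fun k => Num.min `|Gc (x k) 0 i| `|lG k 0 i|)
          @ \oo --> (0 : R),
        forall i, (fun k => Num.min (- Hc (y k) 0 i) `|lH k 0 i|)
          @ \oo --> (0 : R)
      & (fun k => vmin (- Htilde (y k)) (lHt k)) @ \oo --> (0 : 'rV[R]_n)].

End relaxed_problem.

(* Main.v *)
Require Import Defs.
From HB Require Import structures.
From mathcomp Require Import all_boot all_order all_algebra.
From mathcomp Require Import all_classical all_reals all_analysis.

Set Implicit Arguments.
Unset Strict Implicit.
Unset Printing Implicit Defensive.

Import Order.TTheory GRing.Theory Num.Theory.
Import numFieldNormedType.Exports.

Local Open Scope classical_set_scope.
Local Open Scope ring_scope.

(* Complementarity and the bounds 0 <= ybar <= 1 make I_0+ u I_01 (where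
   ybar > 0) the complement of I_00 u I_+-0 (where ybar = 0).  If a point is
   AW-stationary, condition (5) forces lambda^G_i -> 0 off I_0 and condition
   (6) forces lambda^H_i -> 0 on I_0+ u I_01; G and H being linear, setting
   these multipliers to 0 changes the gradient of the Lagrangian by a vanishing
   amount, and what remains is an AKKT sequence for the tightened problem.
   Conversely, an AKKT sequence, with its missing multipliers lambda^G_i
   (i outside I_0) set to 0, is an AW sequence: conditions (5) and (6) hold at
   the remaining indices because x_i -> 0 on I_0 and y_i -> 0 on I_00 u I_+-0. *)

(** * Limits, inequalities and minima of row vectors, by blocks and by selected components *)

Section row_vectors.
Context {R : realType}.

Lemma cvg_rowP N (u : nat -> 'rV[R]_N) (v : 'rV[R]_N) :
  u @ \oo --> v <-> forall i, (fun k => u k 0 i) @ \oo --> v 0 i.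
Proof.
split=> [uv i|uv].
  exact: (cvg_comp _ _ uv (@coord_continuous _ _ _ 0 i v)).
apply/cvg_ballP => e e0.
have : \forall k \near \oo, forall i, ball (v 0 i) e (u k 0 i).
  apply: filter_forall => i.
  by have /cvg_ballP/(_ e e0) := uv i.
by apply: filterS => k uk; split=> // i j; rewrite ord1.
Qed.

Lemma cvg_row_mxP N1 N2 (u1 : nat -> 'rV[R]_N1) (u2 : nat -> 'rV[R]_N2)
    (v1 : 'rV[R]_N1) (v2 : 'rV[R]_N2) :
  (fun k => row_mx (u1 k) (u2 k)) @ \oo --> row_mx v1 v2 <->
  u1 @ \oo --> v1 /\ u2 @ \oo --> v2.
Proof.
rewrite !cvg_rowP; split=> [uv|[uv1 uv2] i].
  split=> i.
    by have := uv (lshift _ i); under eq_cvg do rewrite row_mxEl; rewrite row_mxEl.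
  by have := uv (rshift _ i); under eq_cvg do rewrite row_mxEr; rewrite row_mxEr.
case: (split_ordP i) => j ->.
  under eq_cvg do rewrite row_mxEl; rewrite row_mxEl; exact: uv1.
under eq_cvg do rewrite row_mxEr; rewrite row_mxEr; exact: uv2.
Qed.

Lemma vle_row_mx N1 N2 (u1 v1 : 'rV[R]_N1) (u2 v2 : 'rV[R]_N2) :
  vle (row_mx u1 u2) (row_mx v1 v2) <-> vle u1 v1 /\ vle u2 v2.
Proof.
split=> [uv|[uv1 uv2] i].
  split=> i; first by have := uv (lshift _ i); rewrite !row_mxEl.
  by have := uv (rshift _ i); rewrite !row_mxEr.
by case: (split_ordP i) => j ->; rewrite ?row_mxEl ?row_mxEr.
Qed.

(** A row of length 0 would make the left side vacuous, hence [N.+1]. *)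
Lemma vle_const_mx N (a b : R) :
  vle (const_mx a : 'rV[R]_N.+1) (const_mx b) <-> a <= b.
Proof. by split=> [/(_ 0)|ab i]; rewrite !mxE. Qed.

Lemma cvg_const_mx N (a : nat -> R) (b : R) :
  (fun k => const_mx (a k) : 'rV[R]_N.+1) @ \oo --> (const_mx b : 'rV[R]_N.+1)
  <-> a @ \oo --> b.
Proof.
have aE i : (fun k => (const_mx (a k) : 'rV[R]_N.+1) 0 i) = a.
  by apply/funext => k /=; rewrite mxE.
by rewrite cvg_rowP; split=> [/(_ 0)|ab i]; rewrite aE mxE.
Qed.

Lemma vmin_row_mx N1 N2 (u1 v1 : 'rV[R]_N1) (u2 v2 : 'rV[R]_N2) :
  vmin (row_mx u1 u2) (row_mx v1 v2) = row_mx (vmin u1 v1) (vmin u2 v2).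
Proof.
by apply/rowP => i; case: (split_ordP i) => j ->;
  rewrite [LHS]mxE !(row_mxEl, row_mxEr) [RHS]mxE.
Qed.

Lemma vmin_const_mx N (a b : R) :
  vmin (const_mx a : 'rV[R]_N) (const_mx b) = const_mx (Num.min a b).
Proof. by apply/rowP => i; rewrite !mxE. Qed.

(** Keeps the length [N], unlike [subvec], so that a truncated multiplier still fits into the
    Lagrangian. *)
Definition restrict N (A : {set 'I_N}) (v : 'rV[R]_N) : 'rV[R]_N :=
  \row_i (if i \in A then v 0 i else 0).

Lemma restrict_setC N (A : {set 'I_N}) (v : 'rV[R]_N) :
  restrict A v + restrict (~: A)%SET v = v.
Proof.
by apply/rowP => i; rewrite !mxE inE; case: ifP; rewrite ?addr0 ?add0r.
Qed.

(** Lets a multiplier of the tightened problem, which has only [#|A|] components, be read as part of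
    a full-length vector. *)
Lemma subvec_surj N (A : {set 'I_N}) (u : 'rV[R]_#|A|) :
  exists v, subvec A v = u.
Proof.
(* Since [enum_val] is injective, the sum has one term for [i] in [A]; off [A] it is empty and gives
   0. *)
exists (\row_i (\sum_(k | enum_val k == i) u 0 k)).
apply/rowP => k; rewrite !mxE (big_pred1 k) // => j.
exact/inj_eq/enum_val_inj.
Qed.

(** Joins the multipliers of the inequalities H_i <= 0 and of the equalities H_i = 0 into one
    vector. *)
Lemma subvec_surj2 N (A B : {set 'I_N}) (u : 'rV[R]_#|A|) (w : 'rV[R]_#|B|) :
  [disjoint A & B]%B -> exists v, subvec A v = u /\ subvec B v = w.
Proof.
move=> AB; have [[v1 <-] [v2 <-]] := (subvec_surj u, subvec_surj w).
exists (\row_i (if i \in A then v1 0 i else v2 0 i)).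
split; apply/rowP => k; rewrite !mxE; first by rewrite enum_valP.
by rewrite (disjointFl AB (enum_valP k)).
Qed.

Lemma vle_subvec N (A : {set 'I_N}) (u v : 'rV[R]_N) :
  vle (subvec A u) (subvec A v) <-> {in A, forall i, u 0 i <= v 0 i}.
Proof.
split=> [uv i iA|uv k]; last by rewrite !mxE; apply/uv/enum_valP.
by have := uv (enum_rank_in iA i); rewrite !mxE enum_rankK_in.
Qed.

Lemma cvg_subvec N (A : {set 'I_N}) (u : nat -> 'rV[R]_N) (v : 'rV[R]_N) :
  (fun k => subvec A (u k)) @ \oo --> subvec A v <->
  {in A, forall i, (fun k => u k 0 i) @ \oo --> v 0 i}.
Proof.
have uE j : (fun k => subvec A (u k) 0 j) = (fun k => u k 0 (enum_val j)).
  by apply/funext => k /=; rewrite mxE.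
rewrite cvg_rowP; split=> [uv i iA|uv j].
  by have := uv (enum_rank_in iA i); rewrite uE mxE enum_rankK_in.
by rewrite uE mxE; apply/uv/enum_valP.
Qed.

Lemma vmin_subvec N (A : {set 'I_N}) (u v : 'rV[R]_N) :
  vmin (subvec A u) (subvec A v) = subvec A (vmin u v).
Proof. by apply/rowP => k; rewrite !mxE. Qed.

Lemma subvecN N (A : {set 'I_N}) (u : 'rV[R]_N) :
  subvec A (- u) = - subvec A u.
Proof. by apply/rowP => k; rewrite !mxE. Qed.

Lemma subvec0 N (A : {set 'I_N}) : subvec A (0 : 'rV[R]_N) = 0.
Proof. by apply/rowP => k; rewrite !mxE. Qed.

End row_vectors.

(** * Constraint gradients weighted by multipliers *)

Section weighted_gradients.
Context {R : realType}.

(** The transposed Jacobian of [F] at [z] applied to [l]; both constraint sums in [AKKT] have this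
    form. *)
Definition wgrad N M (F : 'rV[R]_N -> 'rV[R]_M) (z : 'rV[R]_N) (l : 'rV[R]_M)
    : 'rV[R]_N :=
  \sum_i l 0 i *: grad (fun w => F w 0 i) z.

Lemma wgradD N M (F : 'rV[R]_N -> 'rV[R]_M) z l1 l2 :
  wgrad F z (l1 + l2) = wgrad F z l1 + wgrad F z l2.
Proof.
by rewrite -big_split; apply: eq_bigr => i _; rewrite mxE scalerDl.
Qed.

Lemma wgrad_row_mx N M1 M2 (F1 : 'rV[R]_N -> 'rV[R]_M1)
    (F2 : 'rV[R]_N -> 'rV[R]_M2) z l1 l2 :
  wgrad (fun w => row_mx (F1 w) (F2 w)) z (row_mx l1 l2) =
  wgrad F1 z l1 + wgrad F2 z l2.
Proof.
rewrite [LHS]big_split_ord; congr (_ + _); apply: eq_bigr => i _.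
  have -> : (fun w => row_mx (F1 w) (F2 w) 0 (lshift M2 i)) = (fun w => F1 w 0 i).
    by apply/funext => w; rewrite row_mxEl.
  by rewrite row_mxEl.
have -> : (fun w => row_mx (F1 w) (F2 w) 0 (rshift M1 i)) = (fun w => F2 w 0 i).
  by apply/funext => w; rewrite row_mxEr.
by rewrite row_mxEr.
Qed.

Lemma wgrad_const_mx N (F : 'rV[R]_N -> R) z (a : R) :
  wgrad (fun w => const_mx (F w) : 'rV[R]_1) z (const_mx a) = a *: grad F z.
Proof.
have FE : (fun w => (const_mx (F w) : 'rV[R]_1) 0 0) = F.
  by apply/funext => w; rewrite mxE.
by rewrite /wgrad big_ord1 FE mxE.
Qed.

(** Indices outside [A] have weight 0 in [restrict A l], and [enum_val] matches the others with the
    components of [subvec]. *)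
Lemma wgrad_subvec N M (A : {set 'I_M}) (F : 'rV[R]_N -> 'rV[R]_M) z l :
  wgrad (fun w => subvec A (F w)) z (subvec A l) = wgrad F z (restrict A l).
Proof.
rewrite /wgrad (bigID (mem A)) /= [X in _ + X]big1 ?addr0; last first.
  by move=> i /negPf iA; rewrite mxE iA scale0r.
rewrite [RHS](big_enum_val _) /=; apply: eq_bigr => k _.
have -> : (fun w => subvec A (F w) 0 k) = (fun w => F w 0 (enum_val k)).
  by apply/funext => w; rewrite mxE.
by rewrite !mxE enum_valP.
Qed.

Lemma gradD N (F G : 'rV[R]_N -> R) z :
  differentiable F z -> differentiable G z ->
  grad (fun w => F w + G w) z = grad F z + grad G z.
Proof.
by move=> dF dG; apply/rowP => i; rewrite !mxE deriveD //; exact: diff_derivable.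
Qed.

Lemma gradZ N (F : 'rV[R]_N -> R) (a : R) z :
  differentiable F z -> grad (fun w => a * F w) z = a *: grad F z.
Proof.
by move=> dF; apply/rowP => i; rewrite !mxE deriveZ //; exact: diff_derivable.
Qed.

Lemma differentiable_row_coord N M (F : 'rV[R]_N -> 'rV[R]_M) z i :
  differentiable F z -> differentiable (fun w => F w 0 i) z.
Proof.
move=> dF.
by apply: (@differentiable_comp _ _ _ _ F (fun v => v 0 i)) => //;
  exact: differentiable_coord.
Qed.

(** A sum of functions is the form to which the rules for derivatives of sums apply. *)
Lemma dotE N M (l : 'rV[R]_M) (F : 'rV[R]_N -> 'rV[R]_M) :
  (fun w => dot l (F w)) = \sum_i (fun w => l 0 i * F w 0 i).
Proof. by apply/funext => w /=; rewrite fct_sumE. Qed.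

Lemma differentiable_dot N M (l : 'rV[R]_M) (F : 'rV[R]_N -> 'rV[R]_M) z :
  differentiable F z -> differentiable (fun w => dot l (F w)) z.
Proof.
move=> dF; rewrite dotE; apply: differentiable_sum => i.
exact/differentiableZ/differentiable_row_coord.
Qed.

Lemma grad_dot N M (l : 'rV[R]_M) (F : 'rV[R]_N -> 'rV[R]_M) z :
  differentiable F z -> grad (fun w => dot l (F w)) z = wgrad F z l.
Proof.
move=> dF; apply/rowP => j; rewrite mxE dotE derive_sum; last first.
  by move=> i; apply/diff_derivable/differentiableZ/differentiable_row_coord.
rewrite summxE; apply: eq_bigr => i _.
by rewrite -gradZ ?mxE //; exact: differentiable_row_coord.
Qed.

End weighted_gradients.

(** * Limits of minima, for the complementarity conditions *)

Section limits_of_minima.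
Context {R : realType}.

(** Eventually [u] exceeds [a / 2] while the minimum lies below it, so the minimum is [v]. *)
Lemma cvg0_of_min_cvg0 (u v : nat -> R) (a : R) :
  0 < a -> u @ \oo --> a -> (fun k => Num.min (u k) (v k)) @ \oo --> (0 : R) ->
  v @ \oo --> (0 : R).
Proof.
move=> a0 ua uv; apply: (cvg_trans _ uv); apply: near_eq_cvg.
have a20 : 0 < a / 2 by rewrite divr_gt0.
have a2a : a / 2 < a by rewrite ltr_pdivrMr // ltr_pMr // ltr1n.
near=> k.
have : Num.min (u k) (v k) < u k.
  apply: (@lt_trans _ _ (a / 2)).
    by near: k; exact: (cvgr_lt _ uv).
  by near: k; exact: (cvgr_gt _ ua).
by rewrite gt_min ltxx /= => /ltW vu; rewrite min_r.
Unshelve. all: by end_near. Qed.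

(** The minimum is at most |u| in absolute value: a negative [u] is itself the minimum, and
    otherwise the minimum lies between 0 and [u]. *)
Lemma min_cvg0_of_cvg0 (u v : nat -> R) :
  (forall k, 0 <= v k) -> u @ \oo --> (0 : R) ->
  (fun k => Num.min (u k) (v k)) @ \oo --> (0 : R).
Proof.
move=> v0 u0; apply: norm_cvg0.
apply: (@squeeze_cvgr _ _ _ _ (cst 0) (fun k => `|u k|)).
- apply: nearW => k /=; rewrite normr_ge0 /=.
  have [uk|uk] := leP 0 (u k).
    by rewrite ger0_norm ?le_min ?uk ?v0 // (ger0_norm uk) ge_min lexx.
  by rewrite (min_l (le_trans (ltW uk) (v0 k))) lexx.
- exact: cvg_cst.
- exact/norm_cvg0P.
Qed.

(** Serves the multipliers that are set to 0: [u] is eventually positive, so the minimum is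
    eventually 0. *)
Lemma min0_cvg0 (u : nat -> R) (a : R) :
  0 < a -> u @ \oo --> a -> (fun k => Num.min (u k) 0) @ \oo --> (0 : R).
Proof.
have c0 : (fun _ : nat => 0 : R) @ \oo --> (0 : R) by exact: cvg_cst.
move=> a0 ua; apply: (cvg_trans _ c0); apply: near_eq_cvg.
near=> k; rewrite min_r //; apply: ltW.
by near: k; exact: (cvgr_gt _ ua).
Unshelve. all: by end_near. Qed.

End limits_of_minima.

(** * Differentiability of the constraints and the gradient of the Lagrangian *)

Section gradients_of_the_program.
Context {R : realType} (alpha n m p : nat).
Variables (f : 'rV[R]_n -> R) (g : 'rV[R]_n -> 'rV[R]_m)
          (h : 'rV[R]_n -> 'rV[R]_p).
Hypothesis df : forall x, differentiable f x.
Hypothesis dg : forall x, differentiable g x.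
Hypothesis dh : forall x, differentiable h x.

Implicit Type z : 'rV[R]_(n + n).

Lemma differentiable_comp_lsubmx (W : normedModType R) (F : 'rV[R]_n -> W) z :
  (forall x, differentiable F x) -> differentiable (fun w => F (lsubmx w)) z.
Proof.
move=> dF.
exact: (differentiable_comp (differentiable_lsubmx _) (dF _)).
Qed.

Lemma differentiable_comp_rsubmx (W : normedModType R) (F : 'rV[R]_n -> W) z :
  (forall x, differentiable F x) -> differentiable (fun w => F (rsubmx w)) z.
Proof.
move=> dF.
exact: (differentiable_comp (differentiable_rsubmx _) (dF _)).
Qed.

Lemma differentiable_Gc x : differentiable (@Gc R n) x.
Proof. exact: ex_diff. Qed.

Lemma differentiable_Hc y : differentiable (@Hc R n) y.
Proof. by apply: differentiableN; exact: ex_diff. Qed.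

Lemma differentiable_Htilde y : differentiable (@Htilde R n) y.
Proof. by apply: differentiableB; [exact: ex_diff | exact: differentiable_cst]. Qed.

Lemma differentiable_theta y : differentiable (@theta R alpha n) y.
Proof.
apply: differentiableB; first exact: differentiable_cst.
by apply: differentiable_dot; exact: ex_diff.
Qed.

Lemma grad_Lagrangian z lg lh lt lG lH lHt :
  grad (fun w : 'rV[R]_(n + n) =>
    Lagrangian alpha f g h (lsubmx w) (rsubmx w) lg lh lt lG lH lHt) z =
  grad (fun w => f (lsubmx w)) z + wgrad (fun w => g (lsubmx w)) z lg
  + wgrad (fun w => h (lsubmx w)) z lh
  + lt *: grad (fun w => theta alpha (rsubmx w)) z
  + wgrad (fun w => Gc (lsubmx w)) z lG + wgrad (fun w => Hc (rsubmx w)) z lH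
  + wgrad (fun w => Htilde (rsubmx w)) z lHt.
Proof.
have df' := differentiable_comp_lsubmx z df.
have dg' := differentiable_comp_lsubmx z dg.
have dh' := differentiable_comp_lsubmx z dh.
have dt' := differentiable_comp_rsubmx z differentiable_theta.
have dG' := differentiable_comp_lsubmx z differentiable_Gc.
have dH' := differentiable_comp_rsubmx z differentiable_Hc.
have dHt' := differentiable_comp_rsubmx z differentiable_Htilde.
have dlg := differentiable_dot lg dg'.
have dlh := differentiable_dot lh dh'.
have dlt : differentiable (fun w : 'rV[R]_(n + n) => lt * theta alpha (rsubmx w)) z.
  exact: differentiableZ.
have dlG := differentiable_dot lG dG'.
have dlH := differentiable_dot lH dH'.
have dlHt := differentiable_dot lHt dHt'.
(* Partial sums in the nesting order of the Lagrangian, so that [gradD] can split off the last term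
   each time. *)
have d1 := differentiableD df' dlg.
have d2 := differentiableD d1 dlh.
have d3 := differentiableD d2 dlt.
have d4 := differentiableD d3 dlG.
have d5 := differentiableD d4 dlH.
rewrite [LHS](gradD d5 dlHt) (gradD d4 dlH) (gradD d3 dlG) (gradD d2 dlt).
by rewrite (gradD d1 dlh) (gradD df' dlg) gradZ // !grad_dot.
Qed.

End gradients_of_the_program.

(** * Gradients of the linear constraints G and H *)

Section gradients_of_coordinates.
Context {R : realType}.

Lemma derive_row_coord N (z v : 'rV[R]_N) i :
  'D_v (fun w : 'rV[R]_N => w 0 i) z = v 0 i.
Proof.
have coord_lin : linear (fun w : 'rV[R]_N => w 0 i : R).
  by move=> a u w; rewrite !mxE.
(* A continuous linear map is its own differential; the coordinate is packed as a linear map to use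
   this. *)
pose coordM := GRing.isLinear.Build _ _ _ _ _ coord_lin.
pose coordL : {linear 'rV[R]_N -> R} := HB.pack (fun w : 'rV[R]_N => w 0 i) coordM.
rewrite deriveE; last exact: differentiable_coord.
rewrite (_ : (fun _ => _) = coordL) // diff_lin //.
exact: coord_continuous.
Qed.

Lemma grad_row_coord N (z : 'rV[R]_N) i :
  grad (fun w : 'rV[R]_N => w 0 i) z = delta_mx 0 i.
Proof.
by apply/rowP => j; rewrite mxE derive_row_coord !mxE eq_sym.
Qed.

(** By linearity of G the result is independent of [z], so multipliers tending to 0 contribute a
    vanishing row at any iterates. *)
Lemma wgrad_Gc n (z : 'rV[R]_(n + n)) l :
  wgrad (fun w => Gc (lsubmx w)) z l = row_mx l 0.
Proof.
have gradE i : grad (fun w : 'rV[R]_(n + n) => Gc (lsubmx w) 0 i) z =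
    row_mx (delta_mx 0 i) 0.
  have -> : (fun w : 'rV[R]_(n + n) => Gc (lsubmx w) 0 i) =
      (fun w => w 0 (lshift n i)) by apply/funext => w; rewrite mxE.
  by rewrite grad_row_coord delta_mx_lshift.
have addE (u v : 'rV[R]_n) : row_mx (u + v) (0 : 'rV[R]_n) = row_mx u 0 + row_mx v 0.
  by rewrite add_row_mx addr0.
rewrite [in RHS](row_sum_delta l) (big_morph _ addE (row_mx0 _ _ _ _)).
by apply: eq_bigr => i _; rewrite gradE scale_row_mx scaler0.
Qed.

Lemma wgrad_Hc n (z : 'rV[R]_(n + n)) l :
  wgrad (fun w => Hc (rsubmx w)) z l = row_mx 0 (- l).
Proof.
have gradE i : grad (fun w : 'rV[R]_(n + n) => Hc (rsubmx w) 0 i) z =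
    - row_mx 0 (delta_mx 0 i).
  (* A scalar multiple of a coordinate, so that [gradZ] applies. *)
  have -> : (fun w : 'rV[R]_(n + n) => Hc (rsubmx w) 0 i) =
      (fun w => -1 * w 0 (rshift n i)).
    by apply/funext => w; rewrite !mxE mulN1r.
  rewrite gradZ ?grad_row_coord ?delta_mx_rshift ?scaleN1r //.
  exact: differentiable_coord.
have addE (u v : 'rV[R]_n) : row_mx (0 : 'rV[R]_n) (u + v) = row_mx 0 u + row_mx 0 v.
  by rewrite add_row_mx addr0.
rewrite [in RHS](row_sum_delta l) -sumrN (big_morph _ addE (row_mx0 _ _ _ _)).
by apply: eq_bigr => i _;
  rewrite gradE scalerN scale_row_mx scaler0 opp_row_mx oppr0.
Qed.

End gradients_of_coordinates.

(** * Index sets, feasibility and AKKT sequences of the tightened problem *)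

Section tightened_problem.
Context {R : realType} (alpha n m p : nat).
Variables (f : 'rV[R]_n -> R) (g : 'rV[R]_n -> 'rV[R]_m)
          (h : 'rV[R]_n -> 'rV[R]_p).
Hypothesis df : forall x, differentiable f x.
Hypothesis dg : forall x, differentiable g x.
Hypothesis dh : forall x, differentiable h x.
Variables xbar ybar : 'rV[R]_n.

Lemma I_00_pm0E : (I_00 xbar ybar :|: I_pm0 xbar ybar)%SET =
  [set i | ybar 0 i == 0]%SET.
Proof. by apply/setP => i; rewrite !inE -andb_orl orbN. Qed.

Hypothesis feas : feasible (RP alpha f g h) (row_mx xbar ybar).

Lemma feasible_ybar i : [/\ 0 <= ybar 0 i, ybar 0 i <= 1 &
  xbar 0 i * ybar 0 i = 0].
Proof.
have [/= fi fe] := feas; move: fi fe.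
rewrite row_mxKl row_mxKr -!row_mx0 => /vle_row_mx[_ /vle_row_mx[_]].
move=> /vle_row_mx[/(_ i) Hi /(_ i) Hti] /eq_row_mx[_ /rowP/(_ i)].
move: Hi Hti; rewrite !mxE oppr_le0 subr_le0 => -> ->.
by rewrite mulrN => /eqP; rewrite oppr_eq0 => /eqP.
Qed.

Lemma I_0plus_01E : (I_0plus xbar ybar :|: I_01 xbar ybar)%SET =
  (~: (I_00 xbar ybar :|: I_pm0 xbar ybar))%SET.
Proof.
rewrite I_00_pm0E; apply/setP => i; rewrite !inE -andb_orr.
have [y0 y1 /eqP] := feasible_ybar i; rewrite mulf_eq0.
(* If ybar_i is nonzero, complementarity gives xbar_i = 0, and the bounds leave 0 < ybar_i < 1 or
   ybar_i = 1. *)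
have [->|yn0] := eqVneq (ybar 0 i) 0;
  first by rewrite ltxx (eq_sym 0) oner_eq0 andbF.
by rewrite orbF lt_def yn0 y0 [_ < 1]lt_neqAle y1 andbT => -> /=; case: eqP.
Qed.

(** The inequalities and h = 0 are inherited from (RP); the equalities on G_i and H_i hold by the
    choice of the index sets. *)
Lemma TNLP_feasible : feasible (TNLP alpha f g h xbar ybar) (row_mx xbar ybar).
Proof.
have [/= fi fe] := feas; move: fi fe; split=> /=; move: fi fe;
  rewrite row_mxKl row_mxKr -!row_mx0.
  move=> /vle_row_mx[vg /vle_row_mx[vt /vle_row_mx[vH vHt]]] _.
  do 2![apply/vle_row_mx; split=> //]; apply/vle_row_mx; split=> //.
  by rewrite -(subvec0 (I_0plus xbar ybar :|: I_01 xbar ybar)%SET); apply/vle_subvec.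
move=> _ /eq_row_mx[-> _]; congr (row_mx _ (row_mx _ _)).
  by apply/rowP => k; rewrite !mxE; have := enum_valP k; rewrite inE => /eqP.
apply/rowP => k; rewrite !mxE; apply/eqP; rewrite oppr_eq0.
by have := enum_valP k; move: (enum_val k) => i; rewrite I_00_pm0E inE.
Qed.

Let A := (I_0plus xbar ybar :|: I_01 xbar ybar)%SET.
Let B := (I_00 xbar ybar :|: I_pm0 xbar ybar)%SET.
Let I0 := I_0 xbar.
Let Q := TNLP alpha f g h xbar ybar.

(** Since [A] is the complement of [B], the inequality and equality parts of [lH] add up to all of
    [lH], while G is constrained on [I0] only. *)
Lemma TNLP_gradE z lg lh lt (lG lH lHt : 'rV[R]_n) :
  grad (objective Q) z
  + wgrad (ineq Q) z
      (row_mx lg (row_mx (const_mx lt) (row_mx (subvec A lH) lHt)))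
  + wgrad (equa Q) z
      (row_mx lh (row_mx (subvec I0 lG) (subvec B lH))) =
  grad (fun w : 'rV[R]_(n + n) => Lagrangian alpha f g h (lsubmx w) (rsubmx w)
    lg lh lt (restrict I0 lG) lH lHt) z.
Proof.
rewrite grad_Lagrangian // /Q /TNLP /= !wgrad_row_mx wgrad_const_mx !wgrad_subvec.
rewrite -[in RHS](restrict_setC B lH) wgradD -I_0plus_01E -/A.
by rewrite !addrA [LHS](ACl (1*2*6*3*7*8*4*5)).
Qed.

Lemma vmin_ineq_TNLP x y lg lt (lH lHt : 'rV[R]_n) :
  vmin (- ineq Q (row_mx x y))
    (row_mx lg (row_mx (const_mx lt) (row_mx (subvec A lH) lHt))) =
  row_mx (vmin (- g x) lg) (row_mx (const_mx (Num.min (- theta alpha y) lt))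
    (row_mx (subvec A (vmin (- Hc y) lH)) (vmin (- Htilde y) lHt))).
Proof.
rewrite /Q /TNLP /= row_mxKl row_mxKr !opp_row_mx !vmin_row_mx -subvecN.
by rewrite vmin_subvec -[- const_mx _]/(map_mx _ _) map_const_mx vmin_const_mx.
Qed.

(** Restates AKKT with full-length multipliers, as in [AW_stationary]; the sign and complementarity
    of [lH] are required on [A] only. *)
Lemma AKKT_TNLP_P :
  AKKT Q (row_mx xbar ybar) <->
  exists (x y : nat -> 'rV[R]_n)
         (lg : nat -> 'rV[R]_m) (lh : nat -> 'rV[R]_p) (lt : nat -> R)
         (lG lH lHt : nat -> 'rV[R]_n),
    (forall k, [/\ vle 0 (lg k), 0 <= lt k,
       {in A, forall i, 0 <= lH k 0 i} & vle 0 (lHt k)]) /\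
    [/\ x @ \oo --> xbar /\ y @ \oo --> ybar,
        (fun k => grad (fun z : 'rV[R]_(n + n) =>
             Lagrangian alpha f g h (lsubmx z) (rsubmx z)
               (lg k) (lh k) (lt k) (restrict I0 (lG k)) (lH k) (lHt k))
           (row_mx (x k) (y k))) @ \oo --> (0 : 'rV[R]_(n + n)),
        (fun k => vmin (- g (x k)) (lg k)) @ \oo --> (0 : 'rV[R]_m)
      & (fun k => Num.min (- theta alpha (y k)) (lt k)) @ \oo --> (0 : R)] /\
    {in A, forall i, (fun k => Num.min (- Hc (y k) 0 i) (lH k 0 i))
      @ \oo --> (0 : R)} /\
    (fun k => vmin (- Htilde (y k)) (lHt k)) @ \oo --> (0 : 'rV[R]_n).
Proof.
have AB : [disjoint A & B]%B by rewrite finset.disjoints_subset /A I_0plus_01E.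
(* Zero in the block shape of the inequalities, for the blockwise lemmas. *)
have row0 : 0 = row_mx (0 : 'rV[R]_m) (row_mx (const_mx 0 : 'rV_1)
    (row_mx (subvec A 0) (0 : 'rV[R]_n))) by rewrite subvec0 !row_mx0.
have minHE i (y lH : nat -> 'rV[R]_n) :
    (fun k => vmin (- Hc (y k)) (lH k) 0 i) =
    (fun k => Num.min (- Hc (y k) 0 i) (lH k 0 i)).
  by apply/funext => k; rewrite !mxE.
split.
- move=> [_ [z [la [lb [la0 zcvg gcvg mcvg]]]]].
  (* For each [k], [lH k] takes its [A] part from the H block of [la k] and its [B] part from that
     of [lb k]. *)
  have /choice[lH lHP] k := subvec_surj2 (lsubmx (rsubmx (rsubmx (la k))))
    (rsubmx (rsubmx (lb k))) AB.
  have /choice[lG lGP] k := subvec_surj (lsubmx (rsubmx (lb k))).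
  pose lt k := lsubmx (rsubmx (la k)) 0 0.
  have laE k : la k = row_mx (lsubmx (la k)) (row_mx (const_mx (lt k))
      (row_mx (subvec A (lH k)) (rsubmx (rsubmx (rsubmx (la k)))))).
    have [-> _] := lHP k; rewrite hsubmxK.
    have -> : const_mx (lt k) = lsubmx (rsubmx (la k)).
      by apply/rowP => i; rewrite ord1 mxE.
    by rewrite !hsubmxK.
  have lbE k : lb k = row_mx (lsubmx (lb k))
      (row_mx (subvec I0 (lG k)) (subvec B (lH k))).
    by have [_ ->] := lHP k; rewrite lGP !hsubmxK.
  exists (fun k => lsubmx (z k)), (fun k => rsubmx (z k)), (fun k => lsubmx (la k)),
    (fun k => lsubmx (lb k)), lt, lG, lH, (fun k => rsubmx (rsubmx (rsubmx (la k)))).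
  split.
    move=> k; have la0k := la0 k; rewrite laE row0 in la0k.

      move: la0k => /vle_row_mx[? /vle_row_mx[/vle_const_mx ? /vle_row_mx[/vle_subvec lA ?]]].
    by split=> // i /lA; rewrite mxE.
  have minE : (fun k => vmin (- ineq Q (z k)) (la k)) = (fun k =>
      row_mx (vmin (- g (lsubmx (z k))) (lsubmx (la k)))
        (row_mx (const_mx (Num.min (- theta alpha (rsubmx (z k))) (lt k)))
          (row_mx (subvec A (vmin (- Hc (rsubmx (z k))) (lH k)))
            (vmin (- Htilde (rsubmx (z k))) (rsubmx (rsubmx (rsubmx (la k)))))))).
    by apply/funext => k; rewrite -vmin_ineq_TNLP -laE hsubmxK.
  rewrite minE row0 in mcvg.
  move: mcvg => /cvg_row_mxP[? /cvg_row_mxP[/cvg_const_mx ?]].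
  move=> /cvg_row_mxP[/cvg_subvec HA ?]; split; last first.
    by split=> // i iA; have := HA i iA; rewrite minHE mxE.
  split=> //.
    by apply/cvg_row_mxP; under eq_cvg do rewrite hsubmxK.
  under eq_cvg do rewrite hsubmxK -TNLP_gradE -laE -lbE.
  exact: gcvg.
- move=> [x [y [lg [lh [lt [lG [lH [lHt]]]]]]]].
  move=> [l0 [[[xcvg ycvg] gcvg gmin tmin] [Hmin Htmin]]].
  split; first exact: TNLP_feasible.
  exists (fun k => row_mx (x k) (y k)), (fun k => row_mx (lg k)
    (row_mx (const_mx (lt k)) (row_mx (subvec A (lH k)) (lHt k)))),
    (fun k => row_mx (lh k) (row_mx (subvec I0 (lG k)) (subvec B (lH k)))).
  split.
  + move=> k; have [? ? lA ?] := l0 k; rewrite row0.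
    do 2![apply/vle_row_mx; split=> //]; first exact/vle_const_mx.
    by apply/vle_row_mx; split=> //; apply/vle_subvec => i /lA; rewrite mxE.
  + exact/cvg_row_mxP.
  + under eq_cvg do rewrite TNLP_gradE.
    exact: gcvg.
  + under eq_cvg do rewrite vmin_ineq_TNLP.
    rewrite row0; apply/cvg_row_mxP; split=> //; apply/cvg_row_mxP; split.
      exact/cvg_const_mx.
    apply/cvg_row_mxP; split=> //; apply/cvg_subvec => i iA.
    by rewrite minHE mxE; exact: Hmin.
Qed.

End tightened_problem.

(** The discarded multipliers enter through the linear G and H, so the correction does not involve
    [z]. *)
Lemma grad_Lagrangian_restrict (R : realType) (alpha n m p : nat)
    (f : 'rV[R]_n -> R) (g : 'rV[R]_n -> 'rV[R]_m) (h : 'rV[R]_n -> 'rV[R]_p)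
    (df : forall x, differentiable f x) (dg : forall x, differentiable g x)
    (dh : forall x, differentiable h x) (A B : {set 'I_n})
    (z : 'rV[R]_(n + n)) lg lh lt lG lH lHt :
  grad (fun w : 'rV[R]_(n + n) => Lagrangian alpha f g h (lsubmx w) (rsubmx w)
    lg lh lt (restrict A lG) (restrict B lH) lHt) z =
  grad (fun w : 'rV[R]_(n + n) => Lagrangian alpha f g h (lsubmx w) (rsubmx w)
    lg lh lt lG lH lHt) z
  - row_mx (restrict (~: A)%SET lG) (- restrict (~: B)%SET lH).
Proof.
have -> : row_mx (restrict (~: A)%SET lG) (- restrict (~: B)%SET lH) =
    wgrad (fun w => Gc (lsubmx w)) z (restrict (~: A)%SET lG) +
    wgrad (fun w => Hc (rsubmx w)) z (restrict (~: B)%SET lH).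
  by rewrite wgrad_Gc wgrad_Hc add_row_mx addr0 add0r.
(* Splits only the unrestricted occurrence of [lG], which also appears inside the restrictions. *)
have wGE : wgrad (fun w => Gc (lsubmx w)) z lG = _ :=
  congr1 _ (esym (restrict_setC A lG)).
have wHE : wgrad (fun w => Hc (rsubmx w)) z lH = _ :=
  congr1 _ (esym (restrict_setC B lH)).
rewrite !grad_Lagrangian // wGE wHE !wgradD opprD.
set a := _ + _ *: _.
by rewrite !addrA [RHS](ACl (1*2*4*6*(3*7)*(5*8))) /= !subrr !addr0.
Qed.

Theorem theorem4p5 (R : realType) (alpha n m p : nat)
    (f : 'rV[R]_n -> R) (g : 'rV[R]_n -> 'rV[R]_m) (h : 'rV[R]_n -> 'rV[R]_p)
    (alpha_gt0 : (0 < alpha)%N) (alpha_lt_n : (alpha < n)%N)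
    (f_C1 : continuously_differentiable f)
    (g_C1 : continuously_differentiable g)
    (h_C1 : continuously_differentiable h)
    (xbar ybar : 'rV[R]_n)
    (feas : feasible (RP alpha f g h) (row_mx xbar ybar)) :
  AW_stationary alpha f g h xbar ybar <->
  AKKT (TNLP alpha f g h xbar ybar) (row_mx xbar ybar).
Proof.
have [[df _] [dg _] [dh _]] := And3 f_C1 g_C1 h_C1.
rewrite AKKT_TNLP_P //.
set A := (_ :|: I_01 _ _)%SET; set I0 := I_0 xbar.
pose B := (I_00 xbar ybar :|: I_pm0 xbar ybar)%SET.
have AE : A = (~: B)%SET by exact: I_0plus_01E feas.
have inA i : i \in A -> 0 < ybar 0 i.
  rewrite AE /B I_00_pm0E !inE lt_def => ->.
  by have [] := feasible_ybar feas i.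
have HcE (y : nat -> 'rV[R]_n) i : (fun k => - Hc (y k) 0 i) = (fun k => y k 0 i).
  by apply/funext => k; rewrite mxE opprK.
split.
- move=> [_ [x [y [lg [lh [lt [lG [lH [lHt]]]]]]]]].
  move=> [l0 [[[xcvg ycvg] gcvg gmin tmin] [Gmin Hmin Htmin]]].
  have ycoord i : (fun k => - Hc (y k) 0 i) @ \oo --> ybar 0 i.
    by rewrite HcE; move/cvg_rowP: ycvg.
  (* [lG] stays whole because [AKKT_TNLP_P] restricts it to [I0] itself; [lH] is zeroed on [A]. *)
  exists x, y, lg, lh, lt, lG, (fun k => restrict B (lH k)), lHt.
  have lHA k i : i \in A -> restrict B (lH k) 0 i = 0.
    by rewrite AE inE mxE => /negPf ->.
  split.
    by move=> k; have [? ? ?] := l0 k; split=> // i iA; rewrite lHA.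
  split; last first.
    split=> // i iA; under eq_cvg do rewrite lHA //.
    exact: min0_cvg0 (inA _ iA) (ycoord i).
  split=> //.
  (* This row is the exact change of the gradient caused by the zeroed multipliers. *)
  suff rest : (fun k => row_mx (restrict (~: I0)%SET (lG k))
      (- restrict (~: B)%SET (lH k))) @ \oo --> (0 : 'rV[R]_(n + n)).
    under eq_cvg do rewrite grad_Lagrangian_restrict //.
    by have := cvgB gcvg rest; rewrite subr0; apply.
  rewrite -row_mx0; apply/cvg_row_mxP; split; apply/cvg_rowP => i.
    have [iI0|iI0] := boolP (i \in I0).
      under eq_cvg do rewrite !mxE inE iI0 /=.
      by rewrite mxE; exact: cvg_cst.
    under eq_cvg do rewrite !mxE inE iI0 /=.
    rewrite mxE; apply: norm_cvg0.
    apply: (@cvg0_of_min_cvg0 _ (fun k => `|x k 0 i|) _ `|xbar 0 i|).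
    + by rewrite normr_gt0; rewrite inE in iI0.
    + by apply: cvg_norm; move/cvg_rowP: xcvg.
    + exact: Gmin.
  have [iA|iA] := boolP (i \in A); last first.
    rewrite AE in iA; under eq_cvg do rewrite !mxE (negPf iA) oppr0.
    by rewrite mxE; exact: cvg_cst.
  have iB : i \in (~: B)%SET by rewrite -AE.
  under eq_cvg do rewrite !mxE iB.
  have lH0 : (fun k => lH k 0 i) @ \oo --> (0 : R).
    apply: norm_cvg0.
    exact: cvg0_of_min_cvg0 (inA _ iA) (ycoord i) (Hmin i).
  by have := cvgN lH0; rewrite oppr0 mxE; apply.
- move=> [x [y [lg [lh [lt [lG [lH [lHt]]]]]]]].
  move=> [l0 [[[xcvg ycvg] gcvg gmin tmin] [Hmin Htmin]]].
  split=> //.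
  (* Off [I0] the G multiplier is 0, which makes the minimum in condition (5) equal to 0 there. *)
  exists x, y, lg, lh, lt, (fun k => restrict I0 (lG k)), lH, lHt.
  split; first by move=> k; have [] := l0 k.
  split=> //; split=> // i.
    have [iI0|iI0] := boolP (i \in I0); last first.
      under eq_cvg do
        rewrite [restrict _ _ _ _]mxE (negPf iI0) normr0 (min_r (normr_ge0 _)).
      exact: cvg_cst.
    apply: min_cvg0_of_cvg0 => //; apply/norm_cvg0P.
    by move/cvg_rowP: xcvg => /(_ i); move: iI0; rewrite inE => /eqP ->.
  have [iA|iA] := boolP (i \in A).
    (* On [A] the multiplier is nonnegative, so the absolute value in condition (6) changes
       nothing. *)
    have lHE k : `|lH k 0 i| = lH k 0 i.
      by have [_ _ /(_ i iA)/ger0_norm] := l0 k.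
    by under eq_cvg do rewrite lHE; exact: Hmin.
  (* Off [A], ybar_i = 0, so y_i tends to 0 and the free sign of the multiplier does no harm. *)
  apply: min_cvg0_of_cvg0 => //; rewrite HcE.
  move/cvg_rowP: ycvg => /(_ i).
  by move: iA; rewrite AE /B I_00_pm0E !inE negbK => /eqP ->.
Qed.
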